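(* Let $I$ be a positive integer. Consider two players who each start with $I$ M\&M's and flip one coin per round. On each round, a player eats one M\&M if her coin lands heads and eats none if it lands tails. Suppose each coin is biased, landing heads with probability $p$ and tails with probability $1-p$, all flips being independent. Let $\mathbb{P}(I,I)$ denote the probability that the game ends in a tie. If $0 < p < 1$, then $$\mathbb{P}(I, I) = \sum^{I - 1}_{k = 0} \binom{2I - k - 2}{k} \binom{2I - 2k - 2}{I - k - 1} \left(\frac{p}{2 - p} \right)^{k + 1} \left(\frac{1 - p}{2 - p} \right)^{2I - 2k - 2}.$$ If $p = 0$, then $\mathbb{P}(I, I) = 0$. If $p = 1$, then $\mathbb{P}(I, I) = 1$.
   Context: The game is played in rounds until, at the end of some round, at least one player has no M\&M's remaining. The game ends in a tie if both players eat their last M\&M in the same round; if exactly one player has M\&M's remaining, that player wins. (If the game never terminates, it does not end in a tie.) *)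

(* Defs.v *)
From HB Require Import structures.
From mathcomp Require Import all_boot all_order all_algebra finmap.
From mathcomp Require Import all_classical all_reals all_analysis.

Set Implicit Arguments.
Unset Strict Implicit.
Unset Printing Implicit Defensive.

Import Order.TTheory GRing.Theory Num.Theory.

Local Open Scope classical_set_scope.

(* Mutual (not merely pairwise) independence of a possibly infinite family. *)
Definition mutually_independent (d d' : measure_display)
    (T : measurableType d) (U : measurableType d') (R : realType)
    (P : probability T R) (K : choiceType) (X : K -> {RV P >-> U}) : Prop :=
  forall (J : {fset K}) (B : K -> set U),
    (forall k, measurable (B k)) ->
    P (\bigcap_(k in [set` J]) (X k @^-1` B k)) =
    (\prod_(k <- J) P (X k @^-1` B k))%E.

(* In a sequence of flips, [true] is heads and the flip of index [n] is the
   one of the [n.+1]-th round, so that [remaining m c n] refers to the end of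
   the [n]-th round. Flips made after the end of the game still count in
   [remaining], but [ends_at] and [tie] only look at it up to that moment. *)
Fixpoint remaining (m : nat) (c : nat -> bool) (n : nat) : nat :=
  if n is n'.+1 then remaining m c n' - c n' else m.

Definition someone_out (i j : nat) (c1 c2 : nat -> bool) (n : nat) : bool :=
  (remaining i c1 n == 0) || (remaining j c2 n == 0).

Definition ends_at (i j : nat) (c1 c2 : nat -> bool) (n : nat) : Prop :=
  someone_out i j c1 c2 n /\ forall m, m < n -> ~~ someone_out i j c1 c2 m.

Definition tie (i j : nat) (c1 c2 : nat -> bool) : Prop :=
  exists n, [/\ ends_at i j c1 c2 n,
                remaining i c1 n = 0 & remaining j c2 n = 0].

Definition tie_probability (d : measure_display) (T : measurableType d)
    (R : realType) (P : probability T R)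
    (flip : 'I_2 -> nat -> {RV P >-> bool}) (i j : nat) : \bar R :=
  P [set w | tie i j (fun n => flip ord0 n w) (fun n => flip ord_max n w)].

(* Main.v *)
(** With [I = m.+1], a tie happens exactly when, for some [n], both players have
    eaten [m] times in the first [n] rounds and both eat in the next one. These
    events are disjoint in [n], so by independence the tie probability is
    [p^2 * \sum_n ('C(n, m) p^m (1 - p)^(n - m))^2]. With [x = (1 - p)^2], this is
    a multiple of the diagonal term of the series
    [S i j = \sum_n 'C(n, i) 'C(n, j) x^n], and Pascal's rule gives
    [(1 - x) * S i.+1 j.+1 = x * (S i j + S i j.+1 + S i.+1 j)]. Hence
    [(1 - x) * S i j] sums over lattice paths from (0, 0) to (i, j) with steps
    (1, 0), (0, 1) and (1, 1), each step weighing [y = x / (1 - x)]; grouping the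
    paths to (m, m) by their number [k] of diagonal steps gives the formula. *)
Require Import Defs.
From HB Require Import structures.
From mathcomp Require Import all_boot all_order all_algebra finmap.
From mathcomp Require Import all_classical all_reals all_analysis.
From mathcomp Require Import zify ring lra.

Set Implicit Arguments.
Unset Strict Implicit.
Unset Printing Implicit Defensive.

Import Order.TTheory GRing.Theory Num.Theory.
Import numFieldNormedType.Exports.

Local Open Scope classical_set_scope.
Local Open Scope ring_scope.

(** * Weighted Delannoy numbers and their recurrence *)

(* The number of paths with [k] diagonal steps is the multinomial coefficient
   (i + j - k)! / (k! (i - k)! (j - k)!); the product of binomials below also
   vanishes when [k] exceeds [i] or [j], despite truncated subtraction. *)
Definition delannoy (R : comNzRingType) (y : R) (i j : nat) : R :=
  \sum_(0 <= k < i.+1) ('C(i + j - k, i) * 'C(i, k))%:R * y ^+ (i + j - k).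

Lemma delannoy0n (R : comNzRingType) (y : R) j : delannoy y 0 j = y ^+ j.
Proof. by rewrite /delannoy big_nat1 subn0 !bin0 mul1r. Qed.

Lemma delannoyn0 (R : comNzRingType) (y : R) i : delannoy y i 0 = y ^+ i.
Proof.
rewrite /delannoy big_nat_recl// big_nat big1 => [|k /andP[_ ki]].
  by rewrite addr0 bin0 addn0 subn0 binn mul1r.
by rewrite bin_small ?mul0n ?mul0r//; lia.
Qed.

(** The last step of a path to [(i.+1, j.+1)] is (1, 1), (1, 0) or (0, 1). Algebraically, Pascal's
    rule on both binomials matches the coefficients for each number of diagonal steps. *)
Lemma delannoySS (R : comNzRingType) (y : R) i j :
  delannoy y i.+1 j.+1 =
  y * (delannoy y i j + delannoy y i j.+1 + delannoy y i.+1 j).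
Proof.
rewrite {1}/delannoy big_nat_recl//.
(* The [k = 0] term is split off and the other indices are shifted by one, to align with
   [delannoy y i j]; the top term of the new sum is zero since ['C(i, i.+1) = 0]. *)
have -> : delannoy y i j.+1 = 'C(i + j.+1, i)%:R * y ^+ (i + j.+1) +
    \sum_(0 <= k < i.+1) ('C(i + j - k, i) * 'C(i, k.+1))%:R * y ^+ (i + j - k).
  rewrite /delannoy big_nat_recl// bin0 muln1 subn0; congr (_ + _).
  rewrite big_nat_recr//= [X in _ + X](_ : _ = 0) ?addr0; last first.
    by rewrite ['C(i, i.+1)]bin_small// muln0 mul0r.
  by apply: eq_big_nat => k _; rewrite addnS subSS.
have -> : delannoy y i.+1 j = 'C(i + j.+1, i.+1)%:R * y ^+ (i + j.+1) +
    \sum_(0 <= k < i.+1)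
      ('C(i + j - k, i.+1) * 'C(i.+1, k.+1))%:R * y ^+ (i + j - k).
  rewrite /delannoy big_nat_recl// bin0 muln1 subn0 addSnnS; congr (_ + _).
  by apply: eq_big_nat => k _; rewrite addnS subSS.
rewrite bin0 muln1 subn0.
have -> : 'C(i.+1 + j.+1, i.+1)%:R * y ^+ (i.+1 + j.+1) =
    y * (('C(i + j.+1, i)%:R + 'C(i + j.+1, i.+1)%:R) * y ^+ (i + j.+1)).
  by rewrite addSn binS addnC natrD exprS mulrCA.
have -> : \sum_(0 <= k < i.+1) ('C(i.+1 + j.+1 - k.+1, i.+1) * 'C(i.+1, k.+1))%:R
        * y ^+ (i.+1 + j.+1 - k.+1) =
    y * (delannoy y i j +
      \sum_(0 <= k < i.+1) ('C(i + j - k, i) * 'C(i, k.+1))%:R * y ^+ (i + j - k)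
      + \sum_(0 <= k < i.+1)
         ('C(i + j - k, i.+1) * 'C(i.+1, k.+1))%:R * y ^+ (i + j - k)).
  rewrite -2!big_split/= mulr_sumr; apply: eq_big_nat => k /andP[_ ki].
  have -> : (i.+1 + j.+1 - k.+1 = (i + j - k).+1)%N by lia.
  rewrite -!mulrDl -!natrD exprS mulrCA; congr (_ * (_%:R * _)).
  by rewrite !binS; lia.
by ring.
Qed.

(** * Partial sums of the binomial product series and their limits *)

Definition binom_series (R : comNzRingType) (x : R) (i j N : nat) : R :=
  \sum_(0 <= n < N) ('C(n, i) * 'C(n, j))%:R * x ^+ n.

Lemma binom_series00 (R : comNzRingType) (x : R) N :
  binom_series x 0 0 N.+1 = 1 + x * binom_series x 0 0 N.
Proof.
rewrite /binom_series big_nat_recl// mulr_sumr bin0 mul1r expr0.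
by congr (_ + _); apply: eq_big_nat => n _; rewrite !bin0 !mul1r exprS.
Qed.

Lemma binom_series0S (R : comNzRingType) (x : R) j N :
  binom_series x 0 j.+1 N.+1 =
  x * binom_series x 0 j N + x * binom_series x 0 j.+1 N.
Proof.
rewrite /binom_series big_nat_recl// !mulr_sumr -big_split/=.
rewrite bin0n muln0 mul0r add0r; apply: eq_big_nat => n _.
by rewrite !bin0 !mul1n binS natrD exprS; ring.
Qed.

Lemma binom_seriesC (R : comNzRingType) (x : R) i j :
  binom_series x i j = binom_series x j i.
Proof.
by apply/funext => N; apply: eq_big_nat => n _; rewrite mulnC.
Qed.

(** Pascal's rule on both factors of term [n.+1] gives four products, and the [n = 0] term vanishes.
    Comparing the truncations at [N.+1] and [N] keeps the identity exact. *)
Lemma binom_seriesSS (R : comNzRingType) (x : R) i j N :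
  binom_series x i.+1 j.+1 N.+1 =
  x * (binom_series x i j N + binom_series x i j.+1 N
       + binom_series x i.+1 j N) + x * binom_series x i.+1 j.+1 N.
Proof.
rewrite /binom_series big_nat_recl// -!big_split !mulr_sumr -big_split/=.
rewrite bin0n mul0r add0r; apply: eq_big_nat => n _.
by rewrite !binS !natrM !natrD exprS; ring.
Qed.

(* Convergence of [u] comes for free: [u n <= u n.+1 = b n + x * u n] bounds the
   nondecreasing sequence [u] by [B / (1 - x)]. *)
Lemma cvg_affine_recurrence (R : realType) (x B : R) (u b : nat -> R) :
  0 <= x < 1 -> nondecreasing_seq u -> nondecreasing_seq b ->
  b n @[n --> \oo] --> B -> (forall n, u n.+1 = b n + x * u n) ->
  u n @[n --> \oo] --> B / (1 - x).
Proof.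
move=> /andP[x0 x1] ndu ndb bB uE.
have x1' : 1 - x != 0 by rewrite subr_eq0 gt_eqF.
have bleB n : b n <= B.
  by rewrite -(cvg_lim _ bB)//; apply: nondecreasing_cvgn_le => //; apply: cvgP bB.
have ub n : u n <= B / (1 - x).
  rewrite ler_pdivlMr ?subr_gt0// mulrBr mulr1 lerBlDr.
  rewrite (le_trans (ndu _ _ (leqnSn n)))// uE mulrC lerD2r; exact: bleB.
have /cvg_ex[l ul] : cvgn u.
  by apply: nondecreasing_is_cvgn => //; exists (B / (1 - x)) => _ [n _ <-].
have ul' : u n.+1 @[n --> \oo] --> B + x * l.
  under eq_fun do rewrite uE.
  by apply: cvgD => //; apply: cvgMl_tmp.
have lE : l = B + x * l.
  rewrite -[RHS](cvg_lim _ ul')//; apply/esym/cvg_lim => //.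
  by move: ul; rewrite -cvg_shiftS.
suff -> : B / (1 - x) = l by [].
by apply: (mulIf x1'); rewrite divfK//; lra.
Qed.

Lemma nondecreasing_binom_series (R : numDomainType) (x : R) i j :
  0 <= x -> nondecreasing_seq (binom_series x i j).
Proof.
move=> x0; apply/nondecreasing_seqP => n.
by rewrite /binom_series big_nat_recr//= lerDl mulr_ge0// exprn_ge0.
Qed.

(** All the recurrences are affine with ratio [x], so passing to the limit divides by [1 - x]. This
    turns each factor [x] into [y = x / (1 - x)]: the limits obey [delannoySS], with powers of [y]
    on the boundary. *)
Lemma cvg_binom_series (R : realType) (x : R) i j : 0 <= x < 1 ->
  binom_series x i j N @[N --> \oo] --> delannoy (x / (1 - x)) i j / (1 - x).
Proof.
move=> x01; have /andP[x0 x1] := x01.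
have nd i' j' := @nondecreasing_binom_series R x i' j' x0.
have ndM (b : nat -> R) : nondecreasing_seq b ->
    nondecreasing_seq (fun n => x * b n).
  by move=> ndb m n mn; apply: ler_wpM2l => //; apply: ndb.
have cvg0 k : binom_series x 0 k N @[N --> \oo] --> (x / (1 - x)) ^+ k / (1 - x).
  elim: k => [|k IH].
    apply: (cvg_affine_recurrence x01 (nd _ _) _ _ (binom_series00 x)).
      by move=> m n _.
    exact: cvg_cst.
  rewrite exprS -mulrA mulrAC.
  apply: (cvg_affine_recurrence x01 (nd _ _) (ndM _ (nd _ _)) _
           (binom_series0S x k)).
  exact: cvgMl_tmp.
elim: i j => [j|i IHi]; first by rewrite delannoy0n.
elim=> [|j IHj]; first by rewrite binom_seriesC delannoyn0.
rewrite delannoySS -[X in X / _]mulrA.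
apply: (cvg_affine_recurrence x01 (nd _ _) _ _ (binom_seriesSS x i j)).
  by apply: ndM => m n mn; rewrite !lerD// nd.
apply: cvgMl_tmp; rewrite mulrC !mulrDl.
by apply: cvgD => //; apply: cvgD.
Qed.

(** * Independent coins and the binomial law of head counts *)

Lemma binomial_pmfE (R : realType) n (p : R) k :
  binomial_pmf n p k = 'C(n, k)%:R * p ^+ k * (1 - p) ^+ (n - k).
Proof. by rewrite /binomial_pmf -mulr_natl mulrA. Qed.

Section cylinder.
Context (R : realType) (d : measure_display) (T : measurableType d)
  (P : probability T R) (K : choiceType) (X : K -> {RV P >-> bool}).
Local Open Scope ereal_scope.

Definition cylinder (J : {fset K}) (B : K -> set bool) : set T :=
  \bigcap_(k in [set` J]) (X k @^-1` B k).

Definition heads_in (s : seq K) (w : T) : nat := count (fun k => X k w) s.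

(** Testing on cylinders is enough for the inductions below; quantifying over [J'] makes restriction
    to fewer coins immediate. *)
Definition independent_of (J : {fset K}) (D : set T) : Prop :=
  measurable D /\
  forall (J' : {fset K}) B, (J' `<=` J)%fset ->
    P (cylinder J' B `&` D) = P (cylinder J' B) * P D.

Lemma measurable_flip k (A : set bool) : measurable (X k @^-1` A).
Proof. by rewrite -[X in measurable X]setTI; exact: measurable_funPT. Qed.

Lemma measurable_cylinder J B : measurable (cylinder J B).
Proof.
apply: fin_bigcap_measurable; first exact: finite_fset.
by move=> k _; exact: measurable_flip.
Qed.

Lemma cylinderU J J' B B' : [disjoint J & J']%fset ->
  cylinder J B `&` cylinder J' B' =
  cylinder (J `|` J')%fset (fun k => if k \in J then B k else B' k).
Proof.
move=> JJ'; apply/seteqP; split => w /=.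
  by move=> [wJ wJ'] k /=; rewrite in_fsetE; case: ifPn => [kJ _|_ /= kJ'];
    [exact: wJ|exact: wJ'].
move=> wU; split => k /= kJ.
  by have := wU k; rewrite /= in_fsetE kJ; apply.
have := wU k; rewrite /= in_fsetE kJ orbT.
case: ifPn => [kJ0|_]; last by apply.
by move/fdisjointP : JJ' => /(_ _ kJ0); rewrite kJ.
Qed.

Lemma cylinder1 k B : cylinder [fset k]%fset B = X k @^-1` B k.
Proof.
apply/seteqP; split => w; first by apply; rewrite /= in_fset1.
by move=> wB k' /=; rewrite in_fset1 => /eqP ->.
Qed.

Lemma heads_in_cons k s i :
  [set w | heads_in (k :: s) w = i] =
  ((X k @^-1` [set false]) `&` [set w | heads_in s w = i]) `|`
  ((X k @^-1` [set true]) `&` [set w | (heads_in s w).+1 = i]).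
Proof.
apply/seteqP; split => w /=.
  by case: (X k w) => /=; [right|left].
by case=> -[-> <-].
Qed.

Lemma measurable_heads_in s i : measurable [set w | heads_in s w = i].
Proof.
elim: s i => [i|k s IH i].
  case: (eqVneq i 0%N) => [->|i0].
    by rewrite (_ : mkset _ = setT)//; apply/seteqP; split.
  rewrite (_ : mkset _ = set0)//; apply/seteqP; split=> // w /= /eqP.
  by rewrite eq_sym (negbTE i0).
rewrite heads_in_cons; apply: measurableU; apply: measurableI => //;
  try exact: measurable_flip.
case: i => [|i]; last first.
  rewrite (_ : mkset _ = [set w | heads_in s w = i])//.
  by apply/seteqP; split => w /= => [[]|->].
by rewrite (_ : mkset _ = set0)//; apply/seteqP; split.
Qed.

Hypothesis indep : mutually_independent X.

Lemma probability_cylinder J B :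
  P (cylinder J B) = \prod_(k <- J) P (X k @^-1` B k).
Proof. exact: indep. Qed.

(** Cylinders over disjoint index sets intersect in a cylinder over the union, whose product of
    probabilities splits in two. *)
Lemma cylinder_indep J J' B :
  [disjoint J & J']%fset -> independent_of J (cylinder J' B).
Proof.
move=> JJ'; split; first exact: measurable_cylinder.
move=> I B' IJ; have IJ' := fdisjointWl IJ JJ'.
rewrite cylinderU// !probability_cylinder.
rewrite (perm_big (I ++ J')); last first.
  apply: uniq_perm => //; last by move=> k; rewrite in_fsetE mem_cat.
  rewrite cat_uniq !fset_uniq andbT/=; apply/hasPn => k kJ'.
  by apply/negP => kI; move/fdisjointP : IJ' => /(_ _ kI); rewrite kJ'.
rewrite big_cat/=; congr (_ * _); apply: eq_big_seq => k kI; first by rewrite kI.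
by case: ifPn => // /(fdisjointP IJ'); rewrite kI.
Qed.

Lemma independent_ofS J J' D : (J' `<=` J)%fset ->
  independent_of J D -> independent_of J' D.
Proof.
by move=> JJ' [mD DE]; split => // I B IJ; rewrite DE// (fsubset_trans IJ).
Qed.

Lemma independent_ofI J k B D : k \notin J ->
  independent_of (k |` J)%fset D ->
  independent_of J ((X k @^-1` B) `&` D) /\
  P ((X k @^-1` B) `&` D) = P (X k @^-1` B) * P D.
Proof.
move=> kJ [mD DE].
have PkD : P ((X k @^-1` B) `&` D) = P (X k @^-1` B) * P D.
  rewrite -(cylinder1 k (fun=> B)) DE//.
  by rewrite fsub1set in_fsetE in_fset1 eqxx.
split=> //; split; first by apply: measurableI => //; exact: measurable_flip.
move=> I B' IJ.
have Ik : [disjoint I & [fset k]]%fset.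
  by rewrite fdisjoint_sym fdisjoint1X; apply: contra kJ; exact: (fsubsetP IJ).
rewrite PkD setIA -(cylinder1 k (fun=> B)).
have [_ /(_ I B' (fsubset_refl _)) IE] := cylinder_indep (fun=> B) Ik.
rewrite muleA -IE cylinderU// DE//.
by rewrite fsubUset fsub1set fset1U1 andbT (fsubset_trans IJ)// fsubsetUr.
Qed.

Context (p : R).
Hypothesis heads_prob : forall k, P (X k @^-1` [set true]) = p%:E.
Hypothesis tails_prob : forall k, P (X k @^-1` [set false]) = (1 - p)%:E.

(* Keeping an arbitrary [D] in the statement lets the induction absorb the
   outcome of the first coin of [s] into [D]. *)
Lemma heads_in_law (s : seq K) i D :
  uniq s -> independent_of [fset k in s]%fset D ->
  P ([set w | heads_in s w = i] `&` D) =
  (binomial_pmf (size s) p i)%:E * P D.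
Proof.
elim: s i D => [|k s IH] i D /=.
  move=> _ _; case: i => [|i].
    by rewrite binomial_pmfE !mulr1 mul1e; congr (P _); apply/seteqP; split => w // [].
  rewrite binomial_pmfE bin_small// !mul0r mul0e (_ : _ `&` _ = set0) ?measure0//.
  by apply/seteqP; split => w // [].
move=> /andP[ks us] indD.
have kJ : k \notin [fset k in s]%fset by rewrite in_fset.
have indD' : independent_of (k |` [fset k in s])%fset D.
  by apply: independent_ofS indD; apply/fsubsetP => k'; rewrite !inE.
have mI b i' : measurable ((X k @^-1` [set b]) `&`
    [set w | heads_in s w = i'] `&` D).
  apply: measurableI; last by case: indD.
  by apply: measurableI; [exact: measurable_flip|exact: measurable_heads_in].
have PI b i' : P ((X k @^-1` [set b]) `&` [set w | heads_in s w = i'] `&` D) =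
    (binomial_pmf (size s) p i')%:E *
      (P (X k @^-1` [set b]) * P D).
  rewrite [X in X `&` D]setIC -setIA.
  have [indkD PkD] := independent_ofI [set b] kJ indD'.
  by rewrite IH// PkD.
rewrite heads_in_cons setIUl.
case: i => [|i].
  rewrite [X in _ `|` X](_ : _ = set0); last first.
    by apply/seteqP; split => w // [[_]].
  rewrite setU0 PI tails_prob muleA -EFinM !binomial_pmfE !bin0 !subn0; congr (_%:E * _).
  by rewrite exprS; ring.
rewrite (_ : [set w | (heads_in s w).+1 = i.+1] = [set w | heads_in s w = i]);
  last by apply/seteqP; split => w /=; [case|move=> ->].
have -> : P (((X k @^-1` [set false]) `&` [set w | heads_in s w = i.+1] `&` D)
      `|` ((X k @^-1` [set true]) `&` [set w | heads_in s w = i] `&` D)) =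
    P ((X k @^-1` [set false]) `&` [set w | heads_in s w = i.+1] `&` D) +
    P ((X k @^-1` [set true]) `&` [set w | heads_in s w = i] `&` D).
  apply: measureU => //; apply/seteqP; split => w //.
  by move=> -[[[/= -> _] _] [[/=]]].
have /fineK PD : P D \is a fin_num by apply: fin_num_measure; case: indD.
rewrite !PI tails_prob heads_prob -PD -!EFinM -EFinD !binomial_pmfE binS natrD; congr _%:E.
rewrite subSS exprS.
(* Pascal's rule needs [size s - i = (size s - i.+1).+1], false under truncated subtraction when
   [size s <= i]; there ['C(size s, i.+1)] vanishes. *)
have [si|si] := leqP (size s) i; first by rewrite ['C(_, i.+1)]bin_small//; ring.
by rewrite (_ : (size s - i = (size s - i.+1).+1)%N) ?exprS; [ring|lia].
Qed.

(** [heads_in_law] is used for [t], then for [s] with the event on [t] and [J] as [D]. That this [D]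
    is independent of the coins of [s] follows by merging a cylinder over those coins into the one
    over [J] and reusing the law for [t]. *)
Lemma heads_in2_law (s t : seq K) i j J B : uniq s -> uniq t ->
  [disjoint [fset k in s] & [fset k in t]]%fset ->
  [disjoint [fset k in s] & J]%fset -> [disjoint [fset k in t] & J]%fset ->
  P ([set w | heads_in s w = i] `&`
     ([set w | heads_in t w = j] `&` cylinder J B)) =
  (binomial_pmf (size s) p i)%:E * (binomial_pmf (size t) p j)%:E *
  P (cylinder J B).
Proof.
move=> us ut st sJ tJ.
have HT J' B' : [disjoint [fset k in t] & J']%fset ->
    P ([set w | heads_in t w = j] `&` cylinder J' B') =
    (binomial_pmf (size t) p j)%:E * P (cylinder J' B').
  by move=> tJ'; apply: heads_in_law => //; exact: cylinder_indep.
rewrite heads_in_law// ?HT ?muleA//; split.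
  by apply: measurableI; [exact: measurable_heads_in|exact: measurable_cylinder].
move=> I B' Is; have IJ := fdisjointWl Is sJ.
have [_ /(_ I B' (fsubset_refl _)) IE] := cylinder_indep B IJ.
rewrite setICA cylinderU// HT//; last first.
  by rewrite fdisjointXU tJ andbT fdisjoint_sym (fdisjointWl Is).
by rewrite HT// -cylinderU// IE muleCA.
Qed.

End cylinder.

(** * Ties in terms of head counts *)

Local Open Scope nat_scope.

Lemma count_iotaS (c : nat -> bool) n :
  count c (iota 0 n.+1) = count c (iota 0 n) + c n.
Proof. by rewrite -addn1 iotaD count_cat/= addn0. Qed.

Lemma leq_count_iota (c : nat -> bool) n k : k <= n ->
  count c (iota 0 k) <= count c (iota 0 n).
Proof. by move=> /subnKC <-; rewrite iotaD count_cat leq_addr. Qed.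

Lemma remainingE m c n : remaining m c n = m - count c (iota 0 n).
Proof. by elim: n => [|n IH]; rewrite ?subn0// count_iotaS subnDA -IH. Qed.

(** A round removes at most one M\&M, so before the final round of a tie both players hold exactly
    one. That round has flip index [n], hence the game ends at [n.+1]. *)
Lemma tieSSP m c1 c2 : tie m.+1 m.+1 c1 c2 <->
  exists n, [/\ count c1 (iota 0 n) = m, count c2 (iota 0 n) = m, c1 n & c2 n].
Proof.
split=> [[[|n] [[_ notout] r1 r2]]|[n [h1 h2 c1n c2n]]] //.
  have := notout n (ltnSn n); move: r1 r2.
  rewrite /someone_out !remainingE !count_iotaS; case c1n: (c1 n); case c2n: (c2 n);
    rewrite /= ?addn0 ?addn1 => r1 r2; rewrite negb_or => /andP[/eqP h1 /eqP h2].
    by exists n; split=> //; lia.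
  1-3: by exfalso; lia.
exists n.+1; split; rewrite ?remainingE ?count_iotaS ?c1n ?c2n ?h1 ?h2 ?addn1 ?subnn//.
split=> [|k kn]; rewrite /someone_out !remainingE.
  by rewrite !count_iotaS c1n h1 addn1 subnn.
by rewrite !subn_eq0 negb_or -!ltnNge !ltnS -{1}h1 -h2 !leq_count_iota.
Qed.

(** * Closed form of the diagonal Delannoy value *)

(** Both sides are the multinomial [(2m - k)! / (k! (m - k)! (m - k)!)]. *)
Lemma mul_bin_trinomial m k : k <= m ->
  'C(2 * m - k, m) * 'C(m, k) = 'C(2 * m - k, k) * 'C(2 * m - 2 * k, m - k).
Proof.
move=> km; have f0 n : 0 < n`! by exact: fact_gt0.
apply/eqP; rewrite -(@eqn_pmul2r (k`! * ((m - k)`! * (m - k)`!))) ?muln_gt0 ?f0//.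
apply/eqP; transitivity ((2 * m - k)`!).
  have <- : 'C(2 * m - k, m) * (m`! * (2 * m - k - m)`!) = (2 * m - k)`!.
    by apply: bin_fact; lia.
  rewrite -(bin_fact km) (_ : 2 * m - k - m = m - k); last lia.
  by ring.
have <- : 'C(2 * m - k, k) * (k`! * (2 * m - k - k)`!) = (2 * m - k)`!.
  by apply: bin_fact; lia.
rewrite (_ : 2 * m - k - k = 2 * m - 2 * k); last lia.
have <- : 'C(2 * m - 2 * k, m - k) * ((m - k)`! * (2 * m - 2 * k - (m - k))`!) =
    (2 * m - 2 * k)`! by apply: bin_fact; lia.
rewrite (_ : 2 * m - 2 * k - (m - k) = m - k); last lia.
by ring.
Qed.
Local Close Scope nat_scope.

(** The sums agree term by term, since [1 - x = p * (2 - p)]; the prefactor is the one extracted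
    from the tie series. *)
Lemma central_delannoyE (R : realType) (p : R) (m : nat) : 0 < p < 1 ->
  let x := (1 - p) ^+ 2 in
  p ^+ (2 * m + 2) / x ^+ m * (delannoy (x / (1 - x)) m m / (1 - x)) =
  \sum_(0 <= k < m.+1)
     'C(2 * m.+1 - k - 2, k)%:R * 'C(2 * m.+1 - 2 * k - 2, m.+1 - k - 1)%:R *
     (p / (2 - p)) ^+ (k + 1) * ((1 - p) / (2 - p)) ^+ (2 * m.+1 - 2 * k - 2).
Proof.
move=> /andP[p0 p1] x; rewrite /delannoy mulr_suml mulr_sumr.
apply: eq_big_nat => k /andP[_]; rewrite ltnS => km.
have -> : (2 * m.+1 - k - 2 = 2 * m - k)%N by lia.
have -> : (2 * m.+1 - 2 * k - 2 = 2 * m - 2 * k)%N by lia.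
have -> : (m.+1 - k - 1 = m - k)%N by lia.
rewrite -natrM -mul_bin_trinomial// addnn -mul2n.
(* Writing [m = k + l] turns every exponent into a subtraction-free sum, as [field] requires. *)
set c := _%:R; have [l ->] : exists l, m = (k + l)%N by exists (m - k)%N; lia.
have -> : (2 * (k + l) - k = k + l + l)%N by lia.
have -> : (2 * (k + l) - 2 * k = l + l)%N by lia.
have -> : 1 - x = p * (2 - p) by rewrite /x; ring.
have q0 : 1 - p != 0 by rewrite subr_eq0 gt_eqF.
have r0 : 2 - p != 0 by rewrite gt_eqF// subr_gt0; lra.
have p0' : p != 0 by rewrite gt_eqF.
rewrite /x; move: q0 r0; set q := 1 - p; set r := 2 - p => q0 r0.
have -> : (2 * (k + l) + 2 = k + k + l + l + 2)%N by lia.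
rewrite !(exprAC _ 2) !exprMn !exprVn !(exprMn, exprD) !expr1.
have ak := expf_neq0 k p0'; have al := expf_neq0 l p0'.
have bk := expf_neq0 k q0; have bl := expf_neq0 l q0.
have ck := expf_neq0 k r0; have cl := expf_neq0 l r0.
by field; rewrite p0' r0 ak al bk bl ck cl.
Qed.

(** * The tie probability as a series *)

Section two_players.
Context (R : realType) (d : measure_display) (T : measurableType d)
  (P : probability T R) (p : R) (p01 : 0 <= p <= 1)
  (flip : 'I_2 -> nat -> {RV P >-> bool}).
Hypothesis flip_law : forall (a : 'I_2) (n : nat) (A : set bool),
  distribution P (flip a n) A = bernoulli_prob p A.
Hypothesis flip_indep : mutually_independent (fun k : 'I_2 * nat => flip k.1 k.2).

Let X (k : 'I_2 * nat) := flip k.1 k.2.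

Let rounds (a : 'I_2) (n : nat) := [seq (a, k) | k <- iota 0 n].

(** Shaped for [heads_in2_law]: two counts over the first [n] flips, and a cylinder on the next flip
    of each player. *)
Definition tie_at (m n : nat) : set T :=
  [set w | heads_in X (rounds ord0 n) w = m] `&`
  ([set w | heads_in X (rounds ord_max n) w = m] `&`
   cylinder X [fset (ord0, n); (ord_max, n)]%fset (fun=> [set true])).

Lemma tie_atP m n w : tie_at m n w <->
  [/\ count (fun k => flip ord0 k w) (iota 0 n) = m,
      count (fun k => flip ord_max k w) (iota 0 n) = m,
      flip ord0 n w & flip ord_max n w].
Proof.
rewrite /tie_at /heads_in /= !count_map; split.
  move=> [h0 [h1 c]]; split => //.
    by apply: (c (ord0, n)); rewrite /= !inE eqxx.
  by apply: (c (ord_max, n)); rewrite /= !inE eqxx orbT.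
move=> [h0 h1 f0 f1]; split => //; split => // k.
by rewrite /= !inE => /orP[] /eqP ->.
Qed.

Lemma tie_event m :
  [set w | tie m.+1 m.+1 (fun n => flip ord0 n w) (fun n => flip ord_max n w)] =
  \bigcup_n tie_at m n.
Proof.
apply/seteqP; split => w /=.
  by move=> /tieSSP[n nP]; exists n => //; apply/tie_atP.
by move=> [n _ /tie_atP nP]; apply/tieSSP; exists n.
Qed.

Lemma measurable_tie_at m n : measurable (tie_at m n).
Proof.
apply: measurableI; first exact: measurable_heads_in.
by apply: measurableI; [exact: measurable_heads_in|exact: measurable_cylinder].
Qed.

(** After a tie at [k] the first player's count is [m.+1] and never decreases, so it cannot be [m]
    at a later [n]. *)
Lemma trivIset_tie_at m : trivIset setT (tie_at m).
Proof.
apply: ltn_trivIset => k n kn; apply/seteqP; split => // w.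
move=> [/tie_atP[kE _ kT _] /tie_atP[nE _ _ _]].
have := leq_count_iota (fun k => flip ord0 k w) kn.
by rewrite count_iotaS kT kE nE addn1 ltnn.
Qed.

Lemma probability_flip k b : P (X k @^-1` [set b]) = (if b then p else 1 - p)%:E.
Proof.
have := flip_law k.1 k.2 [set b]; rewrite /distribution /pushforward => ->.
rewrite bernoulli_probE// !diracE; case: b.
  by rewrite mem_set// memNset//= mule1 mule0 adde0.
by rewrite memNset// mem_set//= mule1 mule0 add0e.
Qed.

Lemma probability_tie_at m n :
  P (tie_at m n) = (binomial_pmf n p m ^+ 2 * p ^+ 2)%:E.
Proof.
have sz a : size (rounds a n) = n by rewrite size_map size_iota.
have roundsP a a' k : (a', k) \in rounds a n -> a' = a /\ (k < n)%N.
  by move=> /mapP[i]; rewrite mem_iota => /andP[_ ?] [-> ->].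
have un a : uniq (rounds a n).
  by rewrite map_inj_uniq ?iota_uniq// => i j [].
have notn a : [disjoint [fset k in rounds a n] &
    [fset (ord0 : 'I_2, n); (ord_max, n)]]%fset.
  apply/fdisjointP => -[a' k]; rewrite !inE => /roundsP[_ kn].
  by rewrite !xpair_eqE !(ltn_eqF kn) !andbF.
rewrite /tie_at (heads_in2_law flip_indep (probability_flip ^~ true)
  (probability_flip ^~ false)) ?un ?notn//; last first.
  apply/fdisjointP => -[a k]; rewrite !inE => /roundsP[-> _].
  by apply/negP => /roundsP[].
rewrite !sz (probability_cylinder flip_indep) big_fsetU1 ?inE//= big_seq_fset1.
rewrite (probability_flip (ord0, n) true) (probability_flip (ord_max, n) true).
by rewrite -!EFinM !expr2.
Qed.

Lemma tie_probability_series m : tie_probability flip m.+1 m.+1 =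
  (\sum_(n <oo) (binomial_pmf n p m ^+ 2 * p ^+ 2)%:E)%E.
Proof.
rewrite /tie_probability tie_event measure_semi_bigcup.
- by apply: eq_eseriesr => n _; exact: probability_tie_at.
- exact: measurable_tie_at.
- exact: trivIset_tie_at.
- by apply: bigcup_measurable => n _; exact: measurable_tie_at.
Qed.

End two_players.

Theorem theorem3p1 (R : realType) (d : measure_display) (T : measurableType d)
    (P : probability T R) (p : R) (hp : 0 <= p <= 1)
    (flip : 'I_2 -> nat -> {RV P >-> bool})
    (flip_law : forall (a : 'I_2) (n : nat) (A : set bool),
       distribution P (flip a n) A = bernoulli_prob p A)
    (flip_indep : mutually_independent
       (fun k : 'I_2 * nat => flip k.1 k.2))
    (I : nat) (hI : (0 < I)%N) :
  [/\ 0 < p < 1 ->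
        tie_probability flip I I =
        (\sum_(0 <= k < I)
           'C(2 * I - k - 2, k)%:R * 'C(2 * I - 2 * k - 2, I - k - 1)%:R *
           (p / (2 - p)) ^+ (k + 1) *
           ((1 - p) / (2 - p)) ^+ (2 * I - 2 * k - 2))%:E,
      p = 0 -> tie_probability flip I I = 0%:E
    & p = 1 -> tie_probability flip I I = 1%:E].
Proof.
have series := tie_probability_series hp flip_law flip_indep.
case: I hI => // m _; rewrite series; split => [p01|p0|p1].
- have /andP[p0 p1] := p01; rewrite -central_delannoyE//.
  set x := (1 - p) ^+ 2.
  have q0 : 1 - p != 0 by rewrite subr_eq0 gt_eqF.
  have x01 : 0 <= x < 1 by rewrite sqr_ge0 expr_lt1//; lra.
  (* Here [(1 - p) ^+ (n - m) ^+ 2] is [x ^+ n / x ^+ m] for [m <= n]; terms with [n < m] vanish on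
     both sides. *)
  have partial N : \sum_(0 <= n < N) binomial_pmf n p m ^+ 2 * p ^+ 2 =
      p ^+ (2 * m + 2) / x ^+ m * binom_series x m m N.
    rewrite /binom_series mulr_sumr; apply: eq_big_nat => n _.
    rewrite binomial_pmfE; have [nm|mn] := ltnP n m.
      by rewrite bin_small// !mul0r expr0n /= !mul0r mulr0.
    have -> : x ^+ n = x ^+ m * (1 - p) ^+ (n - m) ^+ 2.
      by rewrite exprAC -exprD subnKC.
    rewrite natrM exprD mulnC exprM.
    by field; rewrite expf_neq0// sqrf_eq0.
  apply: cvg_lim => //; under eq_fun do rewrite sumEFin partial.
  apply: cvg_EFin; first by apply: nearW.
  by apply: cvgMl_tmp; exact: cvg_binom_series.
- by apply: eseries0 => n _ _; rewrite p0 expr0n mulr0.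
(* For [p = 1] the series is turned back into a probability, bounded below by that of [tie_at m m],
   which is 1 because [(1 - p) ^+ 0 = 1]. *)
apply/eqP; rewrite eq_le -series probability_le1; last first.
  rewrite tie_event; apply: bigcup_measurable => n _; exact: measurable_tie_at.
rewrite (@le_trans _ _ (P (tie_at flip m m)))//.
  rewrite (probability_tie_at hp flip_law flip_indep) binomial_pmfE binn subnn p1.
  by rewrite expr0 !(expr1n, mulr1).
rewrite /tie_probability tie_event; apply: le_measure; rewrite ?inE.
- exact: measurable_tie_at.
- by apply: bigcup_measurable => n _; exact: measurable_tie_at.
- exact: bigcup_sup.
Qed.
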